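(* Let $a<b$, $n\ge1$, let $B\in\mathbb{R}^{2n\times4n}$ have row rank $2n$, and let $B_a$ be the function determined by $B$ as in the context. Let $M:[a,b]\to\mathbb{R}^{n\times n}$ and $N_1,N_2:[a,b]\times[a,b]\to\mathbb{R}^{n\times n}$. Suppose $x\in W^{3,2}[a,b]$ is $\mathbb{R}^n$-valued and $B\begin{bmatrix}x(a)^T&x(b)^T&x_s(a)^T&x_s(b)^T\end{bmatrix}^T=0$. Then $$\langle x,\mathcal{P}_{\{M,N_1,N_2\}}x_{ss}\rangle_{L_2}=\langle x_{ss},\mathcal{P}_{\{0,R_1,R_2\}}x_{ss}\rangle_{L_2},$$ where $R_1(s,\theta)=E_1(s,\theta)+E_3(s,\theta)$, $R_2(s,\theta)=E_2(s,\theta)+E_3(s,\theta)$, and $$E_1(s,\theta)=\int_s^b(\eta-s)N_1(\eta,\theta)\,d\eta,$$ $$E_2(s,\theta)=(\theta-s)M(\theta)+\int_\theta^b(\eta-s)N_1(\eta,\theta)\,d\eta+\int_s^\theta(\eta-s)N_2(\eta,\theta)\,d\eta,$$ $$E_3(s,\theta)=B_a(\theta,s)^TM(\theta)+\int_\theta^bB_a(\eta,s)^TN_1(\eta,\theta)\,d\eta+\int_a^\theta B_a(\eta,s)^TN_2(\eta,\theta)\,d\eta .$$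
   Context: The operator $\mathcal{P}_{\{M,N_1,N_2\}}:L_2^n[a,b]\to L_2^n[a,b]$ is $$(\mathcal{P}_{\{M,N_1,N_2\}}x)(s)=M(s)x(s)+\int_a^sN_1(s,\theta)x(\theta)\,d\theta+\int_s^bN_2(s,\theta)x(\theta)\,d\theta,$$ with $M,N_1,N_2$ regular enough (e.g. bounded measurable) that this is a well-defined operator on $L_2^n[a,b]$ and the integrals in the statement exist. $L_2^n[a,b]$ has the standard inner product $\langle x,y\rangle_{L_2}=\int_a^bx(s)^Ty(s)\,ds$. $x_s,x_{ss}$ are first and second derivatives in $s$. $W^{k,2}[a,b]$ is the Sobolev space of functions with derivatives up to order $k$ in $L_2$. Definition of $B_a$ (with $I,0$ being $n\times n$ blocks): $$B_2=B\begin{bmatrix} I & 0 \\ I & (b-a)I \\ 0 & I \\ 0 & I \end{bmatrix},\quad B_3=-B_2^{-1}B\begin{bmatrix} 0 & 0 \\ I & 0 \\ 0 & 0 \\ 0 & I \end{bmatrix},\quad\begin{bmatrix}B_4(s)&B_5(s)\end{bmatrix}=\begin{bmatrix}I&(s-a)I\end{bmatrix}B_3,$$ $$B_a(s,\eta)=B_4(s)(b-\eta)+B_5(s).$$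
   Formalization: The matrix B_2 is additionally assumed invertible: row rank 2n of B does not imply this (periodic boundary conditions x(a)=x(b), x_s(a)=x_s(b) make B_2 singular), and without it B_3 and B_a are undefined. *)

(* Defs.v *)
From HB Require Import structures.
From mathcomp Require Import all_boot all_order all_algebra.
From mathcomp Require Import all_classical all_reals all_analysis.

Set Implicit Arguments.
Unset Strict Implicit.
Unset Printing Implicit Defensive.

Import Order.TTheory GRing.Theory Num.Theory.
Import numFieldNormedType.Exports.

Local Open Scope classical_set_scope.
Local Open Scope ring_scope.

(* Functions on [a, b] are represented by functions on R of which only the
   values on [a, b] are used; elements of L_2 are represented by functions,
   not by almost-everywhere classes. *)

Section Sobolev.
Context {R : realType}.
Implicit Types (a b : R) (f g phi : R -> R).

Definition in_L2 a b f : Prop :=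
  f \_ `[a, b] \in Lfun (@lebesgue_measure R) 2%:E.

(* phi is of class C^1 with compact support in the open interval ]a, b[. *)
Definition test_fun a b phi : Prop :=
  [/\ forall t, derivable phi t 1,
      continuous (derive1 phi) &
      exists c d, [/\ a < c, d < b &
        forall t, t \notin `[c, d]%R -> phi t = 0]].

Definition weak_derivative a b f g : Prop :=
  [/\ in_L2 a b f, in_L2 a b g &
      forall phi, test_fun a b phi ->
        \int[lebesgue_measure]_(s in `[a, b]) (f s * derive1 phi s) =
        - \int[lebesgue_measure]_(s in `[a, b]) (g s * phi s)].

(* W^{k,2}[a,b] *)
Fixpoint sobolev a b (k : nat) f : Prop :=
  match k with
  | 0%N => in_L2 a b f
  | k'.+1 => exists2 g, weak_derivative a b f g & sobolev a b k' g
  end.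

Definition vweak_derivative a b n (x y : R -> 'cV[R]_n) : Prop :=
  forall i, weak_derivative a b (fun s => x s i ord0) (fun s => y s i ord0).

Definition vsobolev a b (k : nat) n (x : R -> 'cV[R]_n) : Prop :=
  forall i, sobolev a b k (fun s => x s i ord0).

End Sobolev.

Section Operator.
Context {R : realType}.

Definition mxint m n (D : set R) (F : R -> 'M[R]_(m, n)) : 'M[R]_(m, n) :=
  \matrix_(i, j) \int[lebesgue_measure]_(t in D) F t i j.

Definition L2dot (a b : R) n (x y : R -> 'cV[R]_n) : R :=
  \int[lebesgue_measure]_(s in `[a, b]) ((x s)^T *m y s) ord0 ord0.

Definition opP (a b : R) n (M : R -> 'M[R]_n) (N1 N2 : R -> R -> 'M[R]_n)
    (x : R -> 'cV[R]_n) (s : R) : 'cV[R]_n :=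
  M s *m x s + mxint `[a, s] (fun t => N1 s t *m x t)
             + mxint `[s, b] (fun t => N2 s t *m x t).

Definition bounded_measurable1 (a b : R) n (M : R -> 'M[R]_n) : Prop :=
  forall i j, measurable_fun `[a, b] (fun s => M s i j) /\
              [bounded M s i j | s in `[a, b]].

Definition bounded_measurable2 (a b : R) n (N : R -> R -> 'M[R]_n) : Prop :=
  forall i j,
    measurable_fun (`[a, b] `*` `[a, b]) (fun z : R * R => N z.1 z.2 i j) /\
    [bounded N z.1 z.2 i j | z in `[a, b] `*` `[a, b]].

End Operator.

Section Boundary.
Context {R : realType} (a b : R) (n : nat).

(* A 2n x 4n matrix is typed with column blocks ((n + n) + (n + n)). *)
Variable B : 'M[R]_(n + n, (n + n) + (n + n)).

Definition B2 : 'M[R]_(n + n) :=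
  B *m col_mx (col_mx (row_mx 1%:M 0) (row_mx 1%:M (b - a)%:M))
              (col_mx (row_mx 0 1%:M) (row_mx 0 1%:M)).

Definition B3 : 'M[R]_(n + n) :=
  - (invmx B2 *m B *m col_mx (col_mx (row_mx 0 0) (row_mx 1%:M 0))
                             (col_mx (row_mx 0 0) (row_mx 0 1%:M))).

Definition B45 (s : R) : 'M[R]_(n, n + n) := row_mx 1%:M (s - a)%:M *m B3.

Definition B4 (s : R) : 'M[R]_n := lsubmx (B45 s).
Definition B5 (s : R) : 'M[R]_n := rsubmx (B45 s).

Definition Ba (s eta : R) : 'M[R]_n := (b - eta) *: B4 s + B5 s.

Variables (M : R -> 'M[R]_n) (N1 N2 : R -> R -> 'M[R]_n).

Definition E1 (s t : R) : 'M[R]_n :=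
  mxint `[s, b] (fun eta => (eta - s) *: N1 eta t).

(* Meaningful for s <= t, the only case in which R2 is evaluated by opP. *)
Definition E2 (s t : R) : 'M[R]_n :=
  (t - s) *: M t
  + mxint `[t, b] (fun eta => (eta - s) *: N1 eta t)
  + mxint `[s, t] (fun eta => (eta - s) *: N2 eta t).

Definition E3 (s t : R) : 'M[R]_n :=
  (Ba t s)^T *m M t
  + mxint `[t, b] (fun eta => (Ba eta s)^T *m N1 eta t)
  + mxint `[a, t] (fun eta => (Ba eta s)^T *m N2 eta t).

Definition R1 (s t : R) : 'M[R]_n := E1 s t + E3 s t.
Definition R2 (s t : R) : 'M[R]_n := E2 s t + E3 s t.

End Boundary.

(* Main.v *)
(* With y = xss, two integrations from a and the boundary conditions, solved
   for (x(a), xs(a)) by inverting B2, give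
     x(eta) = \int_a^b K(eta, s) y(s) ds,
     K(eta, s) = max(0, eta - s) I + Ba(eta, s).
   Substituting this in <x, P y> and exchanging the integrals (Fubini, the
   kernels being bounded) leaves <y, Q y> for the kernel
     Q(s, t) = K(t, s)^T M(t) + \int_a^b K(eta, s)^T N(eta, t) deta,
   where N(eta, t) is N1 for t <= eta and N2 otherwise. The Ba part of Q is E3,
   and the max(0, eta - s) part is E1 for t < s and E2 for s < t. *)

Require Import Defs.
From HB Require Import structures.
From mathcomp Require Import all_boot all_order all_algebra.
From mathcomp Require Import all_classical all_reals all_analysis.
From mathcomp Require Import measurable_realfun.
From mathcomp Require Import ring lra.
Import Order.TTheory GRing.Theory Num.Theory.
Import numFieldNormedType.Exports.
Local Open Scope classical_set_scope.
Local Open Scope ring_scope.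

Set Implicit Arguments.
Unset Strict Implicit.
Unset Printing Implicit Defensive.

(** Two obstacles shape the proof. The derivatives are weak, so the increment formula
    [f d - f a = \int_a^d g] has to be extracted from the test-function identity; explicit piecewise
    quadratic test functions do this for a continuous representative. The second obstacle is that
    kernels and intervals of integration are given by cases. Everything is therefore moved to
    integrals over the whole line, in which an integrable function, zero off [[a, b]], is multiplied
    by kernels that are measurable and bounded at every point. Such kernels are stable under sums,
    products, sections and integration against an integrable function, so a single form of Fubini
    serves for all exchanges, and for [xss] it suffices that L_2 lies in L_1 on a bounded interval.
    The case distinctions return only at the end, where a kernel is cut at one point; the diagonal
    is a null set and its values are never compared. *)

Definition bounded_mfun d (T : measurableType d) (R : realType) (f : T -> R) :=
  measurable_fun setT f /\ exists C, forall x, `|f x| <= C.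

(** * Closure properties of bounded measurable functions *)

Section BoundedMeasurable.
Context d (T : measurableType d) (R : realType).
Implicit Types f g h : T -> R.

Lemma bounded_mfunM f g :
  bounded_mfun f -> bounded_mfun g ->
  bounded_mfun (fun x => f x * g x).
Proof.
move=> [mf [C fC]] [mg [D gD]]; split; first exact: measurable_funM.
by exists (C * D) => x; rewrite normrM ler_pM.
Qed.

Lemma bounded_mfunD f g :
  bounded_mfun f -> bounded_mfun g ->
  bounded_mfun (fun x => f x + g x).
Proof.
move=> [mf [C fC]] [mg [D gD]]; split; first exact: measurable_funD.
by exists (C + D) => x; rewrite (le_trans (ler_normD _ _))// lerD.
Qed.

Lemma bounded_mfun_cst (c : R) : bounded_mfun (fun _ : T => c).
Proof. by split; [exact: measurable_cst|exists `|c|]. Qed.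

Lemma bounded_mfunB f g :
  bounded_mfun f -> bounded_mfun g -> bounded_mfun (fun x => f x - g x).
Proof.
move=> [mf [C fC]] [mg [D gD]]; split; first exact: measurable_funB.
by exists (C + D) => x; rewrite (le_trans (ler_normB _ _))// lerD.
Qed.

Lemma bounded_mfun_sum (I : Type) (r : seq I) (F : I -> T -> R) :
  (forall i, bounded_mfun (F i)) ->
  bounded_mfun (fun x => \sum_(i <- r) F i x).
Proof.
move=> bF; elim: r => [|i r IH].
  by under eq_fun do rewrite big_nil; exact: bounded_mfun_cst.
by under eq_fun do rewrite big_cons; exact: bounded_mfunD.
Qed.

Lemma bounded_mfun_restrict (A : set T) f : measurable A ->
  measurable_fun A f -> [bounded f x | x in A] ->
  bounded_mfun (f \_ A).
Proof.
move=> mA mf [C [_ fC]]; split; first exact/(measurable_restrictT _ mA).1.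
(* The boundedness hypothesis only vouches for constants strictly above [C], hence [C + 1]; the [0]
   serves the points outside [A]. *)
exists (Num.max 0 (C + 1)) => x; rewrite patchE.
case: ifPn => [xA|_]; last first.
  by rewrite normr0 le_max lexx.
by rewrite le_max; apply/orP; right; apply: fC; [rewrite ltrDl|exact: set_mem].
Qed.

End BoundedMeasurable.

Lemma bounded_mfun_comp d1 d2 (T1 : measurableType d1) (T2 : measurableType d2)
    (R : realType) (u : T1 -> T2) (f : T2 -> R) :
  measurable_fun setT u -> bounded_mfun f -> bounded_mfun (f \o u).
Proof.
move=> mu [mf [C fC]]; split; first exact: measurableT_comp.
by exists C => x; exact: fC.
Qed.

(** * Fubini and composition for bounded kernels *)

Section Kernels.
Context {R : realType}.
Notation mu := (@lebesgue_measure R).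
Notation "'L1' f" := (mu.-integrable setT (EFin \o f)) (at level 10).
Notation "'I' f" := (Rintegral mu setT f) (at level 10).
Implicit Types (w y z : R -> R) (H N : R * R -> R).

Lemma bounded_mfun_integrable (h f : R -> R) :
  bounded_mfun h -> L1 f -> L1 (fun x => h x * f x).
Proof.
move=> [mh [C hC]] intf.
apply: (@integrableMr _ (measurableTypeR R) _ mu setT measurableT h
  (EFin \o f)) => //.
exists C; split; first exact: num_real.
by move=> D CD x _; exact: le_trans (hC x) (ltW CD).
Qed.

(** Tonelli: with [|H| <= C], the iterated integral of the absolute value is at most [C] times the
    product of the L_1 norms of [w] and [y]. *)
Lemma integrable_prod_kernel w y H : L1 w -> L1 y -> bounded_mfun H ->
  (mu \x mu)%E.-integrable setT
    (fun z : R * R => (w z.1 * H z * y z.2)%:E).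
Proof.
move=> iw iy [mH [C HC]].
have mw : measurable_fun setT w.
  by apply/measurable_EFinP; exact: measurable_int iw.
have my : measurable_fun setT y.
  by apply/measurable_EFinP; exact: measurable_int iy.
have C0 : 0 <= C by exact: le_trans (HC point).
have mf : measurable_fun setT (fun z : R * R => (w z.1 * H z * y z.2)%:E).
  apply/measurable_EFinP; apply: measurable_funM;
    first apply: measurable_funM => //.
    exact: (measurableT_comp mw measurable_fst).
  exact: (measurableT_comp my measurable_snd).
apply: (proj2 (integrable12ltyP mu mu mf)) => /=.
have iW : (\int[mu]_x (`|w x|)%:E < +oo)%E.
  by case/integrableP : iw.
have iY : (\int[mu]_x (`|y x|)%:E < +oo)%E.
  by case/integrableP : iy.
have mnY : measurable_fun setT (fun x => (`|y x|)%:E).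
  by apply/measurable_EFinP; exact: measurableT_comp.
have mnW : measurable_fun setT (fun x => (`|w x|)%:E).
  by apply/measurable_EFinP; exact: measurableT_comp.
apply: (@le_lt_trans _ _
  (\int[mu]_x ((`|w x|)%:E * (C%:E * \int[mu]_x0 (`|y x0|)%:E)))%E).
  apply: ge0_le_integral => //.
  - by move=> x _; exact: integral_ge0.
  - apply: (measurable_fun_fubini_tonelli_F (m2 := mu)
      (fun z : R * R => `|(w z.1 * H z * y z.2)%:E|%E)) => //.
    exact: measurableT_comp.
  - exact: emeasurable_funM.
  - move=> x _.
    rewrite muleA -EFinM -ge0_integralZl//; last by rewrite lee_fin mulr_ge0.
    apply: ge0_le_integral => //.
    + have mfx : measurable_fun setT (fun t => (w x * H (x, t) * y t)%:E).
        exact: (measurableT_comp mf (pair1_measurable x)).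
      exact: (measurableT_comp (@abse_measurable R setT) mfx).
    + exact: (emeasurable_funM (measurable_cst _)).
    + move=> t _; rewrite -EFinM lee_fin !normrM.
      by rewrite ler_wpM2r// ler_wpM2l.
rewrite ge0_integralZr//; last by rewrite mule_ge0//; exact: integral_ge0.
apply: lte_mul_pinfty => //; first exact: integral_ge0.
  by rewrite ge0_fin_numE//; exact: integral_ge0.
by apply: lte_mul_pinfty.
Qed.

(** Since [H] is bounded at every point, all its sections times an integrable function are
    integrable, with no exceptional null set. The inner real integrals are thus genuine, and [fine]
    can be undone pointwise before applying Fubini. *)
Lemma Rintegral_swap w y H : L1 w -> L1 y -> bounded_mfun H ->
  I (fun e => w e * I (fun s => H (e, s) * y s)) =
  I (fun s => y s * I (fun e => H (e, s) * w e)).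
Proof.
move=> iw iy bH.
have sec1 e : bounded_mfun (fun s => H (e, s)).
  exact: bounded_mfun_comp (pair1_measurable e) bH.
have sec2 s : bounded_mfun (fun e => H (e, s)).
  exact: bounded_mfun_comp (pair2_measurable s) bH.
have i1 e : L1 (fun s => H (e, s) * y s).
  exact: (bounded_mfun_integrable (sec1 e)).
have i2 s : L1 (fun e => H (e, s) * w e).
  exact: (bounded_mfun_integrable (sec2 s)).
have := Fubini (integrable_prod_kernel iw iy bH) => /= F.
rewrite /Rintegral; congr fine.
transitivity (\int[mu]_x \int[mu]_y0 (w x * H (x, y0) * y y0)%:E)%E.
  apply: eq_integral => e _; rewrite EFinM fineK; last first.
    exact: (integrable_fin_num measurableT (i1 e)).
  rewrite -integralZl//; last exact: i1.
  by apply: eq_integral => s _; rewrite -EFinM mulrA.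
rewrite F; apply: eq_integral => s _; rewrite EFinM fineK; last first.
  exact: (integrable_fin_num measurableT (i2 s)).
rewrite -integralZl//; last exact: i2.
by apply: eq_integral => e _; rewrite -EFinM; congr EFin; ring.
Qed.

Lemma bounded_mfun_Rintegral y H : L1 y -> bounded_mfun H ->
  bounded_mfun (fun e => I (fun s => H (e, s) * y s)).
Proof.
move=> iy [mH [C HC]].
have my : measurable_fun setT y.
  by apply/measurable_EFinP; exact: measurable_int iy.
have mf : measurable_fun setT (fun z : R * R => (H z * y z.2)%:E).
  apply/measurable_EFinP; apply: measurable_funM => //.
  exact: (measurableT_comp my measurable_snd).
have bs e : bounded_mfun (fun s => H (e, s)).
  by apply: bounded_mfun_comp (pair1_measurable e) _; split => //; exists C.
split.
  apply: (measurableT_comp (@fine_measurable R setT measurableT)).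
  (* Tonelli gives measurability of partial integrals of nonnegative functions only, hence the split
     into positive and negative parts. *)
  rewrite [X in measurable_fun _ X](_ : _ = (fun e =>
      \int[mu]_s ((fun z : R * R => (H z * y z.2)%:E)^\+ (e, s)) -
      \int[mu]_s ((fun z : R * R => (H z * y z.2)%:E)^\- (e, s)))%E);
    last first.
    apply/funext => e; rewrite integralE.
    by congr (_ - _)%E; apply: eq_integral => s _;
      rewrite ?funeposE ?funenegE.
  apply: emeasurable_funB; apply: measurable_fun_fubini_tonelli_F => //.
    exact: measurable_funepos.
  exact: measurable_funeneg.
exists (C * I (fun s => `|y s|)) => e.
have iny : L1 (fun s => `|y s|) by exact: integrable_norm.
rewrite (le_trans (le_normr_Rintegral _ _))//.
  exact: bounded_mfun_integrable.
rewrite -RintegralZl//; apply: le_Rintegral => //.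
- by apply: integrable_norm; exact: bounded_mfun_integrable.
- by apply: bounded_mfun_integrable => //; exact: bounded_mfun_cst.
- by move=> s _; rewrite normrM ler_wpM2r.
Qed.

Lemma bounded_mfun_swap H : bounded_mfun H ->
  bounded_mfun (fun z : R * R => H (z.2, z.1)).
Proof.
apply: (@bounded_mfun_comp _ _ _ _ _ (fun z : R * R => (z.2, z.1)) H).
by apply: measurable_fun_pair; [exact: measurable_snd|exact: measurable_fst].
Qed.

(** With [s] fixed, the bounded section [H (e, s)] is absorbed into the weight [w], and one exchange
    suffices. Joint measurability of the composed kernel in [(s, t)] never has to be established. *)
Lemma Rintegral_kernel_comp1 w z H N s :
  L1 w -> L1 z -> bounded_mfun H -> bounded_mfun N ->
  I (fun t => I (fun e => w e * (H (e, s) * N (e, t))) * z t) =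
  I (fun e => H (e, s) * (I (fun t => N (e, t) * z t) * w e)).
Proof.
move=> iw iz bH bN.
have bs : bounded_mfun (fun e => H (e, s)).
  exact: bounded_mfun_comp (pair2_measurable s) bH.
transitivity (I (fun e => H (e, s) * w e * I (fun t => N (e, t) * z t))).
  rewrite Rintegral_swap//; last exact: bounded_mfun_integrable.
  apply: eq_Rintegral => t _; rewrite mulrC; congr (_ * _).
  by apply: eq_Rintegral => e _; ring.
by apply: eq_Rintegral => e _; ring.
Qed.

(** The inner integral against [z] is a bounded function of [e], so its product with [w] is again an
    integrable weight; this reduces the triple integral to two successive exchanges. *)
Lemma Rintegral_kernel_comp w y z H N :
  L1 w -> L1 y -> L1 z -> bounded_mfun H -> bounded_mfun N ->
  I (fun e => w e * I (fun s => H (e, s) * y s) * I (fun t => N (e, t) * z t)) =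
  I (fun s => y s *
    I (fun t => I (fun e => w e * (H (e, s) * N (e, t))) * z t)).
Proof.
move=> iw iy iz bH bN.
have bc := bounded_mfun_Rintegral iz bN.
transitivity (I (fun e => I (fun t => N (e, t) * z t) * w e *
                          I (fun s => H (e, s) * y s))).
  by apply: eq_Rintegral => e _; ring.
rewrite Rintegral_swap//; last exact: bounded_mfun_integrable.
by apply: eq_Rintegral => s _; rewrite Rintegral_kernel_comp1.
Qed.

Lemma integrable_kernel w y H : L1 w -> L1 y -> bounded_mfun H ->
  L1 (fun s => y s * I (fun e => H (e, s) * w e)).
Proof.
move=> iw iy bH.
rewrite [X in EFin \o X](_ : _ = fun s => I (fun e => H (e, s) * w e) * y s).
  apply: bounded_mfun_integrable => //.
  exact: (bounded_mfun_Rintegral iw (bounded_mfun_swap bH)).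
by apply/funext => s; rewrite mulrC.
Qed.

Lemma integrable_kernel_comp w y z H N :
  L1 w -> L1 y -> L1 z -> bounded_mfun H -> bounded_mfun N ->
  L1 (fun s => y s *
    I (fun t => I (fun e => w e * (H (e, s) * N (e, t))) * z t)).
Proof.
move=> iw iy iz bH bN.
under eq_fun do rewrite (Rintegral_kernel_comp1 _ iw iz bH bN).
apply: integrable_kernel => //; apply: bounded_mfun_integrable => //.
exact: bounded_mfun_Rintegral.
Qed.

Lemma integrable_sum_EFin (J : Type) (r : seq J) (F : J -> R -> R) :
  (forall j, L1 (F j)) -> L1 (fun s => \sum_(j <- r) F j s).
Proof.
move=> iF; elim: r => [|j r iG].
  by under eq_fun do rewrite big_nil; exact: integrable0.
by under eq_fun do rewrite big_cons; exact: (integrableD _ (iF j) iG).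
Qed.

Lemma Rintegral_sum (J : Type) (r : seq J) (F : J -> R -> R) :
  (forall j, L1 (F j)) ->
  I (fun s => \sum_(j <- r) F j s) = \sum_(j <- r) I (F j).
Proof.
move=> iF; elim: r => [|j r IH].
  by under eq_fun do rewrite big_nil; rewrite big_nil Rintegral_cst// mul0r.
under eq_fun do rewrite big_cons; rewrite big_cons RintegralD// ?IH//.
exact: integrable_sum_EFin.
Qed.

End Kernels.

(** * From weak derivatives to the fundamental theorem of calculus *)

Section WeakDerivative.
Context {R : realType}.
Notation mu := (@lebesgue_measure R).
Implicit Types (a b c d e t u : R) (f g : R -> R).

(** Pointwise [|f| <= f^2 + 1], and [[a, b]] has finite measure. *)
Lemma in_L2_integrable a b f : in_L2 a b f ->
  mu.-integrable setT (EFin \o (f \_ `[a, b])).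
Proof.
move=> f2.
have mf : measurable_fun setT (f \_ `[a, b]).
  by move: f2; rewrite /in_L2 inE => /andP[/[!inE]].
have i2 := Lfun2_integrable_sqr f2.
have iab : mu.-integrable setT (EFin \o \1_(`[a, b]%classic : set R)).
  exact: integrable_indic_itv.
pose G x := (f \_ `[a, b]) x ^+ 2 + \1_(`[a, b]%classic : set R) x.
have iG : mu.-integrable setT (EFin \o G) by exact: (integrableD _ i2 iab).
apply: (@le_integrable _ (measurableTypeR R) R mu setT measurableT _ _ _ _ iG).
  exact/measurable_EFinP.
move=> x _ /=; rewrite lee_fin /G patchE indicE; case: ifP => _ /=; last first.
  by rewrite normr0.
rewrite [leRHS]ger0_norm; last by rewrite addr_ge0// sqr_ge0.
rewrite -[_ ^+ 2]real_normK ?num_real//.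
by have := sqr_ge0 (`|f x| - 1); have := normr_ge0 (f x); nra.
Qed.

(** A quadratic remainder bound is insensitive to the knots of a piecewise quadratic function, so
    its derivative needs no case analysis there. *)
Lemma is_derive_quadratic (F : R -> R) (l x : R) (C : R) :
  (forall h, `|F (x + h) - F x - l * h| <= C * h ^+ 2) -> is_derive x 1 F l.
Proof.
move=> FC.
have C0 : 0 <= C.
  by have := le_trans (normr_ge0 _) (FC 1); rewrite expr1n mulr1.
suff cvg_l : h^-1 *: (F (h *: 1 + x) - F x) @[h --> 0^'] --> l.
  apply: DeriveDef; first by apply/cvg_ex; exists l.
  exact/cvg_lim.
apply/cvgrPdist_le => eps eps0; near=> h.
have h0 : h != 0 by near: h; exact: nbhs_dnbhs_neq.
have hn0 : 0 < `|h| by rewrite normr_gt0.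
rewrite -(ler_pM2r hn0) -normrM mulrBl.
rewrite [_%:A]mulr1 /GRing.scale/= mulrAC mulVf// mul1r.
rewrite (addrC h) distrC (le_trans (FC h))//.
rewrite -real_normK ?num_real// expr2 mulrA ler_wpM2r//.
have hC : `|h| <= eps / (C + 1).
  near: h; apply: dnbhs0_le; rewrite divr_gt0//; lra.
rewrite (le_trans (ler_wpM2l C0 hC))// mulrCA ger_pMr// ler_pdivrMr; lra.
Unshelve. all: by end_near. Qed.

Let p u : R := Num.max 0 u.
Let q u : R := (Num.max 0 u) ^+ 2 / 2.

Let q_quadratic u h : `|q (u + h) - q u - p u * h| <= h ^+ 2.
Proof.
rewrite /q /p ler_norml.
by apply/andP; split; case: (lerP 0 u); case: (lerP 0 (u + h)) => *; nra.
Qed.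

Let continuous_p : continuous p.
Proof.
move=> u; apply: (@continuous_max _ _ (fun=> 0) id) => //.
  exact: cvg_cst.
Qed.

(** Second differences with step [e], divided by [e ^+ 2], of the positive part [p] and of its
    primitive [q]. [tent] is the hat of height [1 / e] on [[c, c + 2 * e]], of integral 1. [ramp] is
    its primitive, a C^1 transition from 0 to 1, the second difference of [u^2 / 2] being
    [e ^+ 2]. *)
Definition tent c e t : R :=
  (p (t - c) - 2 * p (t - c - e) + p (t - c - 2 * e)) / e ^+ 2.

Definition ramp c e t : R :=
  (q (t - c) - 2 * q (t - c - e) + q (t - c - 2 * e)) / e ^+ 2.

Lemma is_derive_ramp c e t : is_derive t 1 (ramp c e) (tent c e t).
Proof.
(* The coefficients 1, -2, 1 of the second difference have absolute sum 4. *)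
apply: (@is_derive_quadratic _ _ _ (4 / e ^+ 2)) => h.
have -> : ramp c e (t + h) - ramp c e t - tent c e t * h =
  ((q (t - c + h) - q (t - c) - p (t - c) * h)
   - 2 * (q (t - c - e + h) - q (t - c - e) - p (t - c - e) * h)
   + (q (t - c - 2 * e + h) - q (t - c - 2 * e) - p (t - c - 2 * e) * h))
  / e ^+ 2.
  rewrite /ramp /tent (addrAC t h) (addrAC (t - c) h) (addrAC (t - c) h).
  ring.
rewrite normrM [`|_^-1|]ger0_norm ?invr_ge0 ?sqr_ge0//.
rewrite mulrAC ler_wpM2r ?invr_ge0 ?sqr_ge0//.
move: (q_quadratic (t - c) h) (q_quadratic (t - c - e) h)
  (q_quadratic (t - c - 2 * e) h).
rewrite !ler_norml => /andP[? ?] /andP[? ?] /andP[? ?].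
by apply/andP; split; lra.
Qed.

Lemma continuous_tent c e : continuous (tent c e).
Proof.
have cp k : continuous (fun t => p (t - k)).
  move=> t; apply: (@continuous_comp _ _ _ (fun t => t - k) p).
    by apply: cvgB; [exact: cvg_id|exact: cvg_cst].
  exact: continuous_p.
have -> : tent c e = fun t =>
    (p (t - c) - 2 * p (t - (c + e)) + p (t - (c + 2 * e))) / e ^+ 2.
  by apply/funext => t; rewrite /tent !opprD !addrA.
move=> t; apply: cvgMl; apply: cvgD; last exact: cp.
apply: cvgB; first exact: cp.
by apply: cvgMr; exact: cp.
Qed.

Lemma tent_ge0 c e t : 0 < e -> 0 <= tent c e t.
Proof.
move=> e0; rewrite /tent divr_ge0 ?sqr_ge0// /p.
case: (lerP 0 (t - c)); case: (lerP 0 (t - c - e));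
  case: (lerP 0 (t - c - 2 * e)) => *; lra.
Qed.

Lemma tent_out c e t : 0 < e -> t \notin `[c, c + 2 * e] -> tent c e t = 0.
Proof.
move=> e0; rewrite in_itv/= negb_and -!ltNge /tent /p => /orP h.
apply/eqP; rewrite mulf_eq0; apply/orP; left; apply/eqP.
case: (lerP 0 (t - c)); case: (lerP 0 (t - c - e));
  case: (lerP 0 (t - c - 2 * e)) => *; lra.
Qed.

Lemma ramp_le c e t : 0 < e -> t <= c -> ramp c e t = 0.
Proof.
move=> e0 tc; rewrite /ramp /q !max_l; [|lra..].
by rewrite expr0n/=; ring.
Qed.

Lemma ramp_ge c e t : 0 < e -> c + 2 * e <= t -> ramp c e t = 1.
Proof.
move=> e0 tc; rewrite /ramp /q !max_r; [|lra..].
by field; rewrite gt_eqF.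
Qed.

Lemma ramp_bound c e t : 0 < e -> 0 <= ramp c e t <= 1.
Proof.
move=> e0; have e20 : 0 < e ^+ 2 by rewrite exprn_gt0.
rewrite /ramp ler_pdivlMr// ler_pdivrMr// mul0r mul1r /q.
case: (lerP 0 (t - c)); case: (lerP 0 (t - c - e));
  case: (lerP 0 (t - c - 2 * e)) => *; apply/andP; split; nra.
Qed.

Lemma integrable_continuous_tent a b c e f : a < b ->
  {within `[a, b], continuous f} ->
  mu.-integrable `[a, b] (EFin \o (fun t => f t * tent c e t)).
Proof.
move=> ab cf; apply: continuous_compact_integrable.
  exact: segment_compact.
have ct : {within `[a, b], continuous (tent c e)}.
  by apply: continuous_subspaceT; exact: continuous_tent.
by move=> t; exact: (continuousM (cf t) (ct t)).
Qed.

Lemma Rintegral_tent a b c e : 0 < e -> a < b -> a <= c -> c + 2 * e <= b ->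
  \int[mu]_(t in `[a, b]) tent c e t = 1.
Proof.
move=> e0 ab ac cb; rewrite /Rintegral.
rewrite (@continuous_FTC2 _ (tent c e) (ramp c e))//.
- by rewrite -EFinB/= ramp_ge// ramp_le// subr0.
- by apply: continuous_subspaceT; exact: continuous_tent.
- have dr t : derivable (ramp c e) t 1.
    by apply: ex_derive; exact: is_derive_ramp.
  have cr : continuous (ramp c e).
    by move=> t; apply: differentiable_continuous; exact/derivable1_diffP.
  split => [t _||] //.
  + by apply: cvg_at_right_filter; exact: cr.
  + by apply: cvg_at_left_filter; exact: cr.
- by move=> t _; rewrite derive1E; apply: derive_val; exact: is_derive_ramp.
Qed.

(** [tent] is a probability density, so the integral is a weighted mean of the values of [f] on
    [[c, c + 2 * e]]. *)
Lemma Rintegral_tent_near a b c e x f eps :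
  0 < e -> a < b -> a <= c -> c + 2 * e <= b ->
  {within `[a, b], continuous f} ->
  (forall t, c <= t <= c + 2 * e -> `|f t - f x| <= eps) ->
  `|\int[mu]_(t in `[a, b]) (f t * tent c e t) - f x| <= eps.
Proof.
move=> e0 ab ac cb cf feps.
have ift := integrable_continuous_tent c e ab cf.
have icst k : mu.-integrable `[a, b] (EFin \o (fun t => k * tent c e t)).
  by apply: integrable_continuous_tent => //;
    apply: continuous_subspaceT => ?; exact: cvg_cst.
have it : mu.-integrable `[a, b] (EFin \o tent c e).
  rewrite (_ : tent c e = (fun t => 1 * tent c e t)); first exact: icst.
  by apply/funext => t; rewrite mul1r.
have mab : measurable (`[a, b] : set (measurableTypeR R)).
  exact: measurable_itv.
have lhs : \int[mu]_(t in `[a, b]) (f x * tent c e t) = f x.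
  by rewrite RintegralZl// Rintegral_tent// mulr1.
have rhs : \int[mu]_(t in `[a, b]) (eps * tent c e t) = eps.
  by rewrite RintegralZl// Rintegral_tent// mulr1.
rewrite -lhs -RintegralB// -[leRHS]rhs.
have idiff : mu.-integrable `[a, b]
    (EFin \o (fun t => f t * tent c e t - f x * tent c e t)).
  exact: (integrableB _ ift (icst (f x))).
apply: (le_trans (le_normr_Rintegral _ _)) => //.
apply: le_Rintegral => //; first exact: integrable_norm.
move=> t _; rewrite -mulrBl normrM [`|tent _ _ _|]ger0_norm ?tent_ge0//.
have [tc|tc] := boolP (t \in `[c, c + 2 * e]).
  by rewrite ler_wpM2r ?tent_ge0// feps.
by rewrite tent_out// !mulr0.
Qed.

(* The test functions are differences of ramps, close to the indicator of
   ]a, d[; their derivatives are two opposite bumps, at a and at d. *)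
Lemma weak_derivative_primitive a b d f g :
  weak_derivative a b f g -> {within `[a, b], continuous f} ->
  a <= d -> d <= b -> f d - f a = \int[mu]_(t in `[a, d]) g t.
Proof.
move=> [_ g2 wfg] cf; rewrite le_eqVlt => /predU1P[<- _|ad db].
  by rewrite subrr set_itv1 Rintegral_set1.
have ab : a < b by exact: lt_le_trans db.
have mab : measurable (`[a, b] : set (measurableTypeR R)).
  exact: measurable_itv.
have ig : mu.-integrable `[a, b] (EFin \o g).
  apply/(integrable_mkcond (mu := mu) _ mab).
  by rewrite restrict_EFin; exact: in_L2_integrable.
have mg : measurable_fun `[a, b] g.
  by apply/measurable_EFinP; exact: measurable_int ig.
(* The ramps of [phi] will occupy [[a + e, a + 3 * e]] and [[d - 3 * e, d - e]]. The bound
   [4 * e k <= d - a] gives [a + e <= d - 3 * e] and [a + 3 * e <= d - e], so they cancel outside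
   [[a + e, d - e]], which lies strictly inside []a, b[]. *)
pose e k : R := (d - a) / 4 * harmonic k.
have e0 k : 0 < e k by rewrite mulr_gt0// ?invr_gt0 ?ltr0n//; lra.
have e4 k : 4 * e k <= d - a.
  suff : e k <= (d - a) / 4 by lra.
  rewrite ger_pMr; last lra.
  by rewrite invf_le1 ?ltr0n// ler1n.
have e_small eta : 0 < eta -> \forall k \near \oo, 4 * e k < eta.
  move=> eta0.
  have : e k @[k --> \oo] --> (d - a) / 4 * 0.
    by apply: cvgMr; exact: cvg_harmonic.
  rewrite mulr0 => /cvgrPdist_lt /(_ (eta / 4)) H.
  have : 0 < eta / 4 by lra.
  move=> /H; apply: filterS => k; rewrite sub0r normrN gtr0_norm//; lra.
pose phi k t := ramp (a + e k) (e k) t - ramp (d - 3 * e k) (e k) t.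
have dphi (k : nat) (t : R) : is_derive t 1 (phi k)
    (tent (a + e k) (e k) t - tent (d - 3 * e k) (e k) t).
  by apply: is_deriveB; exact: is_derive_ramp.
have phi'E k : derive1 (phi k) =
    (fun t => tent (a + e k) (e k) t - tent (d - 3 * e k) (e k) t).
  by apply/funext => t; rewrite derive1E; apply: derive_val; exact: dphi.
have testphi k : test_fun a b (phi k).
  split=> [t||].
  - by apply: ex_derive; exact: dphi.
  - rewrite phi'E => t; apply: cvgB; exact: continuous_tent.
  - exists (a + e k), (d - e k); have := e0 k; have := e4 k.
    move=> ? ?; split=> [||t]; [lra..|].
    rewrite in_itv/= negb_and -!ltNge => /orP[?|?]; rewrite /phi.
      by rewrite !ramp_le ?subrr//; lra.
    by rewrite !ramp_ge ?subrr//; lra.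
have near_f x : x \in `[a, b] -> forall eps, 0 < eps ->
    \forall k \near \oo, forall t, t \in `[a, b] -> `|t - x| <= 4 * e k ->
      `|f t - f x| <= eps.
  move=> xab eps eps0.
  have /subspace_continuousP/(_ x xab)/cvgrPdist_le/(_ eps eps0) := cf.
  rewrite near_withinE => /nbhs_ballP[r /= r0 rf].
  apply: filterS (e_small r r0) => k ekr t tab tx.
  rewrite distrC; apply: rf => //; rewrite /ball/= distrC.
  exact: le_lt_trans tx ekr.
have lim_f : (\int[mu]_(t in `[a, b]) (f t * derive1 (phi k) t)) @[k --> \oo]
    --> f a - f d.
  have tent_int (c : R) k := integrable_continuous_tent c (e k) ab cf.
  have lim_at (c : nat -> R) x :
      (forall k, a <= c k) -> (forall k, c k + 2 * e k <= b) ->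
      x \in `[a, b] ->
      (forall k t, c k <= t <= c k + 2 * e k -> `|t - x| <= 4 * e k) ->
      (\int[mu]_(t in `[a, b]) (f t * tent (c k) (e k) t)) @[k --> \oo] --> f x.
    move=> ac cb xab cx; apply/cvgrPdist_le => eps eps0.
    apply: filterS (near_f x xab eps eps0) => k fk; rewrite distrC.
    apply: Rintegral_tent_near => // t tc; apply: fk; last exact: cx.
    by have := ac k; have := cb k; rewrite in_itv/=; lra.
  have -> : (fun k => \int[mu]_(t in `[a, b]) (f t * derive1 (phi k) t)) =
      (fun k => \int[mu]_(t in `[a, b]) (f t * tent (a + e k) (e k) t) -
                \int[mu]_(t in `[a, b]) (f t * tent (d - 3 * e k) (e k) t)).
    apply/funext => k; rewrite -RintegralB//.
    by apply: eq_Rintegral => t _; rewrite phi'E mulrBr.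
  apply: cvgB; apply: lim_at => [k|k||k t]; rewrite ?in_itv/=.
  - by have := e0 k; lra.
  - by have := e4 k; have := e0 k; lra.
  - by apply/andP; split; lra.
  - move=> /andP[? ?]; have := e0 k => ?.
    by rewrite ler_norml; apply/andP; split; lra.
  - by have := e4 k; have := e0 k; lra.
  - by have := e0 k; lra.
  - by apply/andP; split; lra.
  - move=> /andP[? ?]; have := e0 k => ?.
    by rewrite ler_norml; apply/andP; split; lra.
(* Dominated convergence with bound [|g|]: the [phi k] converge at every point to the indicator of
   the open interval []a, d[], and all vanish at its ends. Passing to [[a, d]] only adds two null
   points. *)
have lim_g : (\int[mu]_(t in `[a, b]) (g t * phi k t)) @[k --> \oo]
    --> \int[mu]_(t in `[a, d]) g t.
  have igs : mu.-integrable `[a, d] (EFin \o g).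
    by apply: integrableS ig => //; apply: subset_itvl; rewrite bnd_simp.
  have gE : (\int[mu]_(t in `[a, b]) ((g \_ `]a, d[) t)%:E =
      (\int[mu]_(t in `[a, d]) g t)%:E)%E.
    rewrite -[LHS]fineK; last first.
      apply: (integrable_fin_num mab).
      rewrite (_ : (fun t => _) = (EFin \o g) \_ `]a, d[); last first.
        by rewrite restrict_EFin.
      apply/integrable_restrict => //.
      by apply: integrableS ig => //; exact: measurableI.
    congr EFin; rewrite -/(Rintegral mu `[a, b] (g \_ `]a, d[)).
    rewrite -Rintegral_mkcondr setIidr; last first.
      move=> t /=; rewrite !in_itv/= => /andP[? ?]; apply/andP; split; lra.
    rewrite Rintegral_itv_obnd_cbnd; last first.
      by apply: integrableS igs => //; apply: subset_itv; rewrite bnd_simp.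
    rewrite Rintegral_itv_bndo_bndc//.
    by apply: integrableS igs => //; apply: subset_itv; rewrite bnd_simp.
  apply: fine_cvg; rewrite -gE.
  have mphi k : measurable_fun `[a, b] (phi k).
    apply: measurable_funTS; apply: continuous_measurable_fun => t.
    apply: differentiable_continuous.
    by apply/derivable1_diffP; case: (testphi k).
  have [] := @dominated_convergence _ (measurableTypeR R) R mu `[a, b] mab
    (fun k t => (g t * phi k t)%:E) (fun t => ((g \_ `]a, d[) t)%:E)
    (fun t => `|(g t)%:E|%E) _ _ _ _ _ => //.
  - move=> k; apply/measurable_EFinP; apply: measurable_funM => //.
    exact: mphi.
  - apply/measurable_EFinP/(measurable_restrict _ _ _).1 => //.
    exact: measurable_funS mg.
  - apply: aeW => t tab; apply: cvg_near_cst.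
    rewrite patchE; case: ifPn => [|].
      rewrite inE/= in_itv/= => /andP[at' td].
      have dt0 : 0 < Num.min (t - a) (d - t) by rewrite lt_min !subr_gt0 at' td.
      apply: filterS (e_small _ dt0) => k; rewrite lt_min => /andP[ka kd].
      have := e0 k => ?.
      by rewrite /phi ramp_ge ?ramp_le ?subr0 ?mulr1//; lra.
    rewrite notin_setE/= in_itv/= => /negP; rewrite negb_and -!leNgt => tad.
    apply: nearW => k; have := e0 k => ?; have := e4 k => ?.
    congr EFin; rewrite /phi; case/orP: tad => ?.
      by rewrite !ramp_le ?subrr ?mulr0//; lra.
    by rewrite !ramp_ge ?subrr ?mulr0//; lra.
  - exact: integrable_abse.
  - apply: aeW => t k tab; rewrite lee_fin normrM ler_piMr// /phi ler_norml.
    have /andP[? ?] := ramp_bound (a + e k) t (e0 k).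
    have /andP[? ?] := ramp_bound (d - 3 * e k) t (e0 k).
    by apply/andP; split; lra.
have lim_f' : (\int[mu]_(t in `[a, b]) (f t * derive1 (phi k) t)) @[k --> \oo]
    --> - \int[mu]_(t in `[a, d]) g t.
  rewrite (_ : (fun k => _) =
      (fun k => - \int[mu]_(t in `[a, b]) (g t * phi k t))).
    exact: cvgN.
  by apply/funext => k; rewrite wfg.
have fadE : f a - f d = - \int[mu]_(t in `[a, d]) g t.
  exact: (cvg_unique _ lim_f lim_f').
by rewrite -[LHS]opprB fadE opprK.
Qed.

End WeakDerivative.

(** * Double integration from the left end as a bounded kernel *)

Section Representation.
Context {R : realType}.
Notation mu := (@lebesgue_measure R).
Notation "'I' f" := (Rintegral mu setT f) (at level 10).
Variables (a b : R).

(* The identity cut off to [0] outside [a, b]: composing a kernel with it makes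
   the kernel bounded on the whole plane. *)
Definition cutoff : R -> R := (fun t : R => t) \_ `[a, b].

Lemma cutoffE t : t \in `[a, b] -> cutoff t = t.
Proof. by move=> tab; rewrite /cutoff patchE mem_set. Qed.

Lemma bounded_mfun_cutoff : bounded_mfun cutoff.
Proof.
apply: bounded_mfun_restrict => //.
exists (Num.max `|a| `|b|); split; first exact: num_real.
move=> C abC t /=; rewrite in_itv/= => /andP[ta tb].
apply: le_trans (ltW abC); rewrite le_max !ler_norml.
have := ler_norm b; have := ler_norm (- a); rewrite normrN.
case: (lerP 0 t) => *; apply/orP; [right|left]; apply/andP; split; lra.
Qed.

Lemma bounded_mfun_max0 d (T : measurableType d) (f : T -> R) :
  bounded_mfun f -> bounded_mfun (fun t => Num.max 0 (f t)).
Proof.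
move=> [mf [C fC]]; split; first exact: measurable_maxr.
by exists C => t; apply: le_trans (fC t); case: (lerP 0 (f t)); rewrite ?normr0.
Qed.

Lemma bounded_mfun_le : bounded_mfun (fun z : R * R => (z.2 <= z.1)%R%:R : R).
Proof.
have mle : measurable_fun setT (fun z : R * R => (z.2 <= z.1)%R).
  exact: (measurable_fun_ler (@measurable_snd _ _ R R)
                             (@measurable_fst _ _ R R)).
split; last by exists 1 => z; rewrite ger0_norm ?ler0n// lern1 leq_b1.
rewrite (_ : (fun z : R * R => _) =
    (fun z : R * R => if (z.2 <= z.1)%R then 1 else 0)).
  exact: measurable_fun_ifT.
by apply/funext => z; case: (_ <= _).
Qed.

(* The kernel [max 0 (eta - s)] of double integration from [a]. *)
Definition ramp_kernel (z : R * R) : R :=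
  Num.max 0 (cutoff z.1 - cutoff z.2).

Lemma bounded_mfun_ramp_kernel : bounded_mfun ramp_kernel.
Proof.
apply: bounded_mfun_max0; apply: bounded_mfunB.
  exact: (bounded_mfun_comp measurable_fst bounded_mfun_cutoff).
exact: (bounded_mfun_comp measurable_snd bounded_mfun_cutoff).
Qed.

(** This is the inner integral left after exchanging the two integrations from [a], hence the origin
    of the ramp kernel; for [e < s] the domain is empty. *)
Lemma Rintegral_indic_le s e : a <= s -> e <= b ->
  I (fun t => (s <= t)%R%:R * \1_(`[a, e]%classic : set R) t) =
  Num.max 0 (e - s).
Proof.
move=> as_ eb.
transitivity (\int[mu]_(t in `[s, e]) (1 : R)).
  rewrite [RHS]Rintegral_mkcond; apply: eq_Rintegral => t _.
  rewrite patchE indicE.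
  have -> : (t \in (`[s, e]%classic : set R)) = (s <= t) && (t <= e).
    by apply/idP/idP; rewrite ?inE/= in_itv.
  have -> : (t \in (`[a, e]%classic : set R)) = (a <= t) && (t <= e).
    by apply/idP/idP; rewrite ?inE/= in_itv.
  have [st|st] := lerP s t; last by rewrite mul0r.
  by rewrite (le_trans as_ st) mul1r; case: (t <= e).
rewrite Rintegral_cst; last exact: measurable_itv.
rewrite mul1r [X in fine X](lebesgue_measure_itv `[s, e])/= lte_fin.
by case: ltP => se; [rewrite max_r//=; lra|rewrite max_l//=; lra].
Qed.

Lemma Rintegral_itv_le (g : R -> R) t : t \in `[a, b] ->
  \int[mu]_(s in `[a, t]) g s = I (fun s => (s <= t)%R%:R * (g \_ `[a, b]) s).
Proof.
rewrite in_itv/= => /andP[at_ tb].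
rewrite Rintegral_mkcond; apply: eq_Rintegral => s _; rewrite !patchE.
have -> : (s \in (`[a, t]%classic : set R)) = (a <= s) && (s <= t).
  by apply/idP/idP; rewrite ?inE/= in_itv.
have -> : (s \in (`[a, b]%classic : set R)) = (a <= s) && (s <= b).
  by apply/idP/idP; rewrite ?inE/= in_itv.
have [st|st] := lerP s t; last by rewrite andbF mul0r.
by rewrite (le_trans st tb) mul1r.
Qed.

(** Taylor's formula with integral remainder. The inner primitive is written with the kernel of
    [s <= t], the outer one with the indicator of [[a, e]], and one exchange merges them. *)
Lemma double_primitive (f f1 f2 : R -> R) e :
  weak_derivative a b f f1 -> weak_derivative a b f1 f2 ->
  {within `[a, b], continuous f} -> {within `[a, b], continuous f1} ->
  e \in `[a, b] ->
  f e = f a + (e - a) * f1 a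
        + I (fun s => ramp_kernel (e, s) * (f2 \_ `[a, b]) s).
Proof.
move=> wf wf1 cf cf1 eab; have := eab; rewrite in_itv/= => /andP[ae eb].
have iY := in_L2_integrable (let: And3 _ h _ := wf1 in h).
set Y := f2 \_ `[a, b].
pose w : R -> R := \1_(`[a, e]%classic : set R).
have iw : mu.-integrable setT (EFin \o w) by exact: integrable_indic_itv.
have bY := bounded_mfun_Rintegral iY bounded_mfun_le.
have f1E t : t \in `[a, b] -> f1 t = f1 a + I (fun s => (s <= t)%R%:R * Y s).
  move=> tab; rewrite -Rintegral_itv_le//.
  have := tab; rewrite in_itv/= => /andP[at_ tb].
  by rewrite -(weak_derivative_primitive wf1 cf1 at_ tb) addrC subrK.
apply/eqP; rewrite -addrA addrC -subr_eq; apply/eqP.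
rewrite (weak_derivative_primitive wf cf ae eb).
transitivity (I (fun t => w t * f1 a + w t * I (fun s => (s <= t)%R%:R * Y s))).
  rewrite Rintegral_mkcond; apply: eq_Rintegral => t _.
  rewrite patchE /w indicE; case: ifPn => [te|_]; last by rewrite !mul0r addr0.
  rewrite !mul1r f1E//; move: te; rewrite inE/= !in_itv/= => /andP[-> te].
  exact: le_trans te eb.
have iwc : mu.-integrable setT (EFin \o (fun t => w t * f1 a)).
  under eq_fun do rewrite mulrC.
  by apply: bounded_mfun_integrable => //; exact: bounded_mfun_cst.
rewrite RintegralD//; last first.
  under eq_fun do rewrite mulrC.
  exact: (bounded_mfun_integrable bY).
congr (_ + _).
  rewrite RintegralZr//; congr (_ * _).
  (* The length [e - a] is the case [s = a] of [Rintegral_indic_le]. *)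
  rewrite -[RHS](_ : Num.max 0 (e - a) = _); last by rewrite max_r// subr_ge0.
  rewrite -Rintegral_indic_le//; apply: eq_Rintegral => t _; rewrite /w indicE.
  case: (boolP (t \in _)) => te; rewrite ?mulr0//.
  by move: te; rewrite inE/= in_itv/= => /andP[-> _]; rewrite mulr1.
rewrite (Rintegral_swap iw iY bounded_mfun_le) /=.
apply: eq_Rintegral => s _; rewrite mulrC.
rewrite /Y patchE; case: ifPn => [sab|_]; last by rewrite !mulr0.
congr (_ * _); move: sab; rewrite inE/= => sab.
rewrite /ramp_kernel /= !cutoffE//.
move: sab; rewrite in_itv/= => /andP[as_ sb].
by rewrite -Rintegral_indic_le.
Qed.

End Representation.

(** * Solving the boundary conditions; boundedness of [Ba] *)

Section Boundary.
Context {R : realType} (a b : R) (n : nat).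
Variable B : 'M[R]_(n + n, (n + n) + (n + n)).

(** Here [x0], [x1] are the values of [x] and [xs] at [a], while [z1] and [z2] will be the integrals
    of [(b - s) y(s)] and [y(s)]. The boundary vector is linear in both pairs: the matrix in [B2]
    acts on the first, the one in [B3] on the second. *)
Lemma boundary_solve (x0 x1 z1 z2 : 'cV[R]_n) : B2 a b B \in unitmx ->
  B *m col_mx (col_mx x0 (x0 + (b - a) *: x1 + z1)) (col_mx x1 (x1 + z2)) = 0 ->
  col_mx x0 x1 = B3 a b B *m col_mx z1 z2.
Proof.
move=> B2u bc.
pose V : 'M[R]_((n + n) + (n + n), n + n) :=
  col_mx (col_mx (row_mx 0 0) (row_mx 1%:M 0))
         (col_mx (row_mx 0 0) (row_mx 0 1%:M)).
have {}bc : B2 a b B *m col_mx x0 x1 = - (B *m V *m col_mx z1 z2).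
  apply/eqP; rewrite -addr_eq0 -[X in _ == X]bc /B2 /V -!mulmxA -mulmxDr.
  rewrite !mul_col_mx !mul_row_col !add_col_mx !mul1mx !mul0mx !mul_scalar_mx.
  by rewrite !addr0 !add0r.
by rewrite -[LHS](mulKmx B2u) bc /B3 -/V mulmxN mulNmx !mulmxA.
Qed.

(** The entries are polynomials, affine in each variable, hence bounded once both variables are cut
    off. *)
Lemma BaE (e s : R) i l : Ba a b B e s i l =
  (b - s) * (B3 a b B (lshift n i) (lshift n l) +
             (e - a) * B3 a b B (rshift n i) (lshift n l)) +
  (B3 a b B (lshift n i) (rshift n l) +
   (e - a) * B3 a b B (rshift n i) (rshift n l)).
Proof.
rewrite /Ba /B4 /B5 /B45 -[X in row_mx _ _ *m X]vsubmxK mul_row_col mul1mx.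
by rewrite mul_scalar_mx !mxE.
Qed.

Lemma bounded_mfun_Ba i l :
  bounded_mfun (fun z : R * R =>
    Ba a b B (cutoff a b z.1) (cutoff a b z.2) i l).
Proof.
have b1 := bounded_mfun_comp (@measurable_fst _ _ R R)
  (bounded_mfun_cutoff a b).
have b2 := bounded_mfun_comp (@measurable_snd _ _ R R)
  (bounded_mfun_cutoff a b).
under eq_fun do rewrite BaE.
have bc k : bounded_mfun (fun _ : R * R => k : R) := bounded_mfun_cst _ k.
have bea k : bounded_mfun (fun z : R * R => (cutoff a b z.1 - a) * k).
  exact: (bounded_mfunM (bounded_mfunB b1 (bc a)) (bc k)).
have bs := bounded_mfunB (bc b) b2.
exact: (bounded_mfunD (bounded_mfunM bs (bounded_mfunD (bc _) (bea _)))
                      (bounded_mfunD (bc _) (bea _))).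
Qed.

End Boundary.

(** * Cutting an integral at one point *)

Section SplitIntegral.
Context {R : realType}.
Notation mu := (@lebesgue_measure R).
Notation "'L1' f" := (mu.-integrable setT (EFin \o f)) (at level 10).
Notation "'I' f" := (Rintegral mu setT f) (at level 10).

(** The cut point is null, so [F1] and [F2] are unconstrained there. This absorbs all disagreements
    on the diagonal. Their integrability is inherited from [F]. *)
Lemma Rintegral_split (a b c : R) (F F1 F2 : R -> R) :
  c \in `[a, b] -> L1 (F \_ `[a, b]) ->
  (forall t, a <= t < c -> F1 t = F t) ->
  (forall t, c < t <= b -> F2 t = F t) ->
  \int[mu]_(t in `[a, c]) F1 t + \int[mu]_(t in `[c, b]) F2 t =
  I (F \_ `[a, b]).
Proof.
rewrite in_itv/= => /andP[ac cb] iF F1E F2E.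
have mab : measurable (`[a, b] : set (measurableTypeR R)).
  exact: measurable_itv.
have iFab : mu.-integrable `[a, b] (EFin \o F).
  by apply/(integrable_mkcond _ mab); rewrite restrict_EFin.
have iFac : mu.-integrable `[a, c[ (EFin \o F).
  by apply: integrableS iFab => //; apply: subset_itv; rewrite bnd_simp.
have iFcb : mu.-integrable `]c, b] (EFin \o F).
  by apply: integrableS iFab => //; apply: subset_itv; rewrite bnd_simp.
have F1E' : {in (`[a, c[%classic : set R), F1 =1 F}.
  by move=> t; rewrite inE/= in_itv/= => /F1E.
have F2E' : {in (`]c, b]%classic : set R), F2 =1 F}.
  by move=> t; rewrite inE/= in_itv/= => /F2E.
have iF1 : mu.-integrable `[a, c[ (EFin \o F1).
  by apply: (@eq_integrable _ (measurableTypeR R) R mu _ _ (EFin \o F))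
    => // t /F1E' /= ->.
have iF2 : mu.-integrable `]c, b] (EFin \o F2).
  by apply: (@eq_integrable _ (measurableTypeR R) R mu _ _ (EFin \o F))
    => // t /F2E' /= ->.
rewrite -(Rintegral_itv_bndo_bndc iF1) -(Rintegral_itv_obnd_cbnd iF2).
rewrite (@eq_Rintegral _ (measurableTypeR R) R mu _ F F1 F1E').
rewrite (@eq_Rintegral _ (measurableTypeR R) R mu _ F F2 F2E').
rewrite (Rintegral_itv_bndo_bndc iFac) -(Rintegral_itvB (x := c) iFab)//.
by rewrite addrC subrK -Rintegral_mkcond.
Qed.

End SplitIntegral.

(** * Operators of the form [opP] through a single kernel *)

Section Operators.
Context {R : realType} (a b : R) (n : nat).
Notation mu := (@lebesgue_measure R).
Notation "'L1' f" := (mu.-integrable setT (EFin \o f)) (at level 10).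
Notation "'I' f" := (Rintegral mu setT f) (at level 10).
Variable y : R -> 'cV[R]_n.

Let Y l := (fun s => y s l ord0) \_ `[a, b].
Hypothesis iY : forall l, L1 (Y l).

(** Only [Q] has to be bounded and measurable; [F1] and [F2] are seen through their agreement with
    it. Thus nothing about the measurability of [R1] and [R2] has to be proved directly. *)
Lemma opPE (Mm : R -> 'M[R]_n) (F1 F2 : R -> R -> 'M[R]_n)
    (Q : 'I_n -> R -> R) s i :
  s \in `[a, b] -> (forall j, bounded_mfun (Q j)) ->
  (forall j t, a <= t < s -> F1 s t i j = Q j t) ->
  (forall j t, s < t <= b -> F2 s t i j = Q j t) ->
  opP a b Mm F1 F2 y s i ord0 =
  \sum_j Mm s i j * y s j ord0 + \sum_j I (fun t => Q j t * Y j t).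
Proof.
move=> sab bQ F1Q F2Q; rewrite /opP !mxE -addrA; congr (_ + _).
pose F t := \sum_j Q j t * y t j ord0.
have iQ j : L1 (fun t => Q j t * Y j t) by exact: bounded_mfun_integrable.
have FE : F \_ `[a, b] = fun t => \sum_j Q j t * Y j t.
  apply/funext => t; rewrite patchE /F /Y; case: ifPn => tab.
    by apply: eq_bigr => j _; rewrite patchE tab.
  by rewrite big1// => j _; rewrite patchE (negbTE tab) mulr0.
rewrite (Rintegral_split (F := F) sab).
- by rewrite FE Rintegral_sum.
- by rewrite FE; exact: integrable_sum_EFin.
- by move=> t tas; rewrite mxE; apply: eq_bigr => j _; rewrite F1Q.
- by move=> t tas; rewrite mxE; apply: eq_bigr => j _; rewrite F2Q.
Qed.

End Operators.

(** * The composed kernel and its identification with [E1], [E2], [E3] *)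

Section KernelForm.
Context {R : realType} (a b : R) (n : nat).
Notation mu := (@lebesgue_measure R).
Notation "'L1' f" := (mu.-integrable setT (EFin \o f)) (at level 10).
Notation "'I' f" := (Rintegral mu setT f) (at level 10).
Variables (B : 'M[R]_(n + n, (n + n) + (n + n))).
Variables (M : R -> 'M[R]_n) (N1 N2 : R -> R -> 'M[R]_n).
Hypotheses (ab : a < b) (B2u : B2 a b B \in unitmx).
Hypotheses (bmM : bounded_measurable1 a b M)
  (bmN1 : bounded_measurable2 a b N1) (bmN2 : bounded_measurable2 a b N2).

Let chi : R -> R := \1_(`[a, b]%classic : set R).

Let ichi : L1 chi. Proof. exact: integrable_indic_itv. Qed.

Let K i l (z : R * R) : R :=
  (i == l)%:R * ramp_kernel a b z +
  Ba a b B (cutoff a b z.1) (cutoff a b z.2) i l.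

(** The choice is written with indicators, and both blocks are extended by zero off the square, so
    that boundedness follows from the closure properties. *)
Let N i j (z : R * R) : R :=
  (z.2 <= z.1)%R%:R *
    ((fun z => N1 z.1 z.2 i j) \_ (`[a, b] `*` `[a, b])) z +
  (1 - (z.2 <= z.1)%R%:R) *
    ((fun z => N2 z.1 z.2 i j) \_ (`[a, b] `*` `[a, b])) z.

Let bounded_K i l : bounded_mfun (K i l).
Proof.
apply: bounded_mfunD; last exact: bounded_mfun_Ba.
exact: (bounded_mfunM (bounded_mfun_cst _ _) (bounded_mfun_ramp_kernel a b)).
Qed.

Let bounded_N i j : bounded_mfun (N i j).
Proof.
have msq : measurable ((`[a, b] `*` `[a, b]) : set (R * R)).
  by apply: measurableX; exact: measurable_itv.
have [mN1 bN1] := bmN1 i j; have [mN2 bN2] := bmN2 i j.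
have ble := @bounded_mfun_le R.
apply: bounded_mfunD.
  exact: (bounded_mfunM ble (bounded_mfun_restrict msq mN1 bN1)).
exact: (bounded_mfunM (bounded_mfunB (bounded_mfun_cst _ _) ble)
         (bounded_mfun_restrict msq mN2 bN2)).
Qed.

Let NE_lt i j e t : e \in `[a, b] -> t \in `[a, b] -> t < e ->
  N i j (e, t) = N1 e t i j.
Proof.
move=> eab tab te; rewrite /N /= (ltW te) subrr mul0r addr0 mul1r patchE.
by rewrite mem_set.
Qed.

Let NE_gt i j e t : e \in `[a, b] -> t \in `[a, b] -> e < t ->
  N i j (e, t) = N2 e t i j.
Proof.
move=> eab tab te; rewrite /N /= leNgt te/= subr0 mul0r add0r mul1r patchE.
by rewrite mem_set.
Qed.

Let chiM (f : R -> R) : (fun t => chi t * f t) = f \_ `[a, b].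
Proof.
by apply/funext => t; rewrite /chi indicE patchE; case: (t \in _);
  rewrite ?mul1r ?mul0r.
Qed.

Let bounded_section (H : R * R -> R) t :
  bounded_mfun H -> bounded_mfun (fun e => H (e, t)).
Proof. by move=> bH; exact: (bounded_mfun_comp (pair2_measurable t) bH). Qed.

Let i_chi (f : R -> R) : bounded_mfun f -> L1 (fun e => chi e * f e).
Proof.
move=> bf; under eq_fun do rewrite mulrC; exact: bounded_mfun_integrable.
Qed.

(** The ramp vanishes for [e < s], and [t < s < e] leaves only [N1]; the integral is therefore cut
    at [s], with zero on the left. *)
Let E1E s t l j : s \in `[a, b] -> t \in `[a, b] -> t < s ->
  E1 b N1 s t l j =
  I (fun e => chi e * (ramp_kernel a b (e, s) * N l j (e, t))).
Proof.
move=> sab tab ts; rewrite /E1 mxE chiM.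
pose F e := ramp_kernel a b (e, s) * N l j (e, t).
have iF : L1 (F \_ `[a, b]).
  rewrite -chiM; apply: i_chi; apply: bounded_mfunM; apply: bounded_section.
    exact: bounded_mfun_ramp_kernel.
  exact: bounded_N.
have := sab; rewrite in_itv/= => /andP[as_ sb].
rewrite -(Rintegral_split (F1 := fun=> 0)
  (F2 := fun e => ((e - s) *: N1 e t) l j) sab iF).
- by rewrite Rintegral_cst ?mul0r ?add0r//; exact: measurable_itv.
- move=> e /andP[ae es]; rewrite /F /ramp_kernel/= !cutoffE//.
    by rewrite max_l ?mul0r//; lra.
  by rewrite in_itv/= ae; lra.
- move=> e /andP[se eb].
  have eab : e \in `[a, b] by rewrite in_itv/= eb andbT; lra.
  rewrite mxE /F /ramp_kernel/= !cutoffE// NE_lt//; last lra.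
  by rewrite max_r//; lra.
Qed.

Let E2E s t l j : s \in `[a, b] -> t \in `[a, b] -> s < t ->
  E2 b M N1 N2 s t l j = (t - s) * M t l j +
    I (fun e => chi e * (ramp_kernel a b (e, s) * N l j (e, t))).
Proof.
move=> sab tab st; rewrite /E2 !mxE -addrA chiM; congr (_ + _).
pose F e := ramp_kernel a b (e, s) * N l j (e, t).
have iF : L1 (F \_ `[a, b]).
  rewrite -chiM; apply: i_chi; apply: bounded_mfunM; apply: bounded_section.
    exact: bounded_mfun_ramp_kernel.
  exact: bounded_N.
have := sab; rewrite in_itv/= => /andP[as_ sb].
have := tab; rewrite in_itv/= => /andP[at_ tb].
(* The integral is extended down to [a], where the positive part of [e - s] is zero, so that a cut
   at [t] covers all of [[a, b]]. *)
have -> : \int[mu]_(e in `[s, t]) ((e - s) *: N2 e t) l j =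
    \int[mu]_(e in `[a, t]) (Num.max 0 (e - s) * N2 e t l j).
  rewrite Rintegral_mkcond [RHS]Rintegral_mkcond; apply: eq_Rintegral => e _.
  rewrite !patchE mxE.
  have -> : (e \in (`[s, t]%classic : set R)) = (s <= e) && (e <= t).
    by apply/idP/idP; rewrite ?inE/= in_itv.
  have -> : (e \in (`[a, t]%classic : set R)) = (a <= e) && (e <= t).
    by apply/idP/idP; rewrite ?inE/= in_itv.
  have [se|es] := lerP s e.
    by rewrite (le_trans as_ se) max_r// subr_ge0.
  by rewrite max_l ?mul0r ?if_same// subr_le0 ltW.
rewrite addrC -(Rintegral_split (F := F)
  (F1 := fun e => Num.max 0 (e - s) * N2 e t l j)
  (F2 := fun e => ((e - s) *: N1 e t) l j) tab iF)//.
- move=> e /andP[ae et].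
  have eab : e \in `[a, b] by rewrite in_itv/= ae; lra.
  by rewrite /F /ramp_kernel/= !cutoffE// NE_gt.
- move=> e /andP[te eb].
  have eab : e \in `[a, b] by rewrite in_itv/= eb andbT; lra.
  rewrite mxE /F /ramp_kernel/= !cutoffE// NE_lt//.
  by rewrite max_r//; lra.
Qed.

(** Unlike the ramp, [Ba] has no break at [e = s]: the only cut is at [t], whatever the order of [s]
    and [t]. Hence the same [E3] enters [R1] and [R2]. *)
Let E3E s t l j : s \in `[a, b] -> t \in `[a, b] ->
  E3 a b B M N1 N2 s t l j = \sum_i Ba a b B t s i l * M t i j +
    \sum_i I (fun e => chi e *
      (Ba a b B (cutoff a b e) (cutoff a b s) i l * N i j (e, t))).
Proof.
move=> sab tab; rewrite /E3 !mxE -addrA; congr (_ + _).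
  by apply: eq_bigr => i _; rewrite mxE.
have bF i : bounded_mfun (fun e =>
    Ba a b B (cutoff a b e) (cutoff a b s) i l * N i j (e, t)).
  apply: bounded_mfunM; last exact: bounded_section.
  exact: (bounded_section s (bounded_mfun_Ba a b B i l)).
pose F e := \sum_i Ba a b B (cutoff a b e) (cutoff a b s) i l * N i j (e, t).
have iF : L1 (F \_ `[a, b]).
  by rewrite -chiM; apply: i_chi; exact: bounded_mfun_sum.
rewrite addrC (Rintegral_split (F := F) tab iF).
- rewrite -chiM -Rintegral_sum; last by move=> i; exact: i_chi.
  by apply: eq_Rintegral => e _; rewrite mulr_sumr.
- have := tab; rewrite in_itv/= => /andP[at_ tb] e /andP[ae et].
  have eab : e \in `[a, b] by rewrite in_itv/= ae; lra.
  rewrite mxE /F; apply: eq_bigr => i _.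
  by rewrite mxE !cutoffE// NE_gt.
- have := tab; rewrite in_itv/= => /andP[at_ tb] e /andP[te eb].
  have eab : e \in `[a, b] by rewrite in_itv/= eb andbT; lra.
  rewrite mxE /F; apply: eq_bigr => i _.
  by rewrite mxE !cutoffE// NE_lt.
Qed.

Let Q l j s t : R :=
  \sum_i (K i l (t, s) * ((fun t => M t i j) \_ `[a, b]) t +
          I (fun e => chi e * (K i l (e, s) * N i j (e, t)))).

Let QE s t l j : s \in `[a, b] -> t \in `[a, b] ->
  Q l j s t = ramp_kernel a b (t, s) * M t l j +
    I (fun e => chi e * (ramp_kernel a b (e, s) * N l j (e, t))) +
    E3 a b B M N1 N2 s t l j.
Proof.
move=> sab tab; rewrite E3E// addrACA /Q.
(* The ramp multiplies the identity matrix. Its single term [i = l] is expanded into a sum over [i]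
   to be matched termwise with [Q]. *)
have sum_l (f : 'I_n -> R) : f l = \sum_i (i == l)%:R * f i.
  rewrite (bigD1 l)//= eqxx mul1r big1 ?addr0// => i /negbTE ->.
  by rewrite mul0r.
rewrite (sum_l (fun i => ramp_kernel a b (t, s) * M t i j)).
rewrite (sum_l (fun i =>
  I (fun e => chi e * (ramp_kernel a b (e, s) * N i j (e, t))))).
rewrite -!big_split/=; apply: eq_bigr => i _.
have bR := bounded_section s (bounded_mfun_ramp_kernel a b).
have bB := bounded_section s (bounded_mfun_Ba a b B i l).
have bNt := bounded_section t (bounded_N i j).
have iR := i_chi (bounded_mfunM bR bNt).
have iB := i_chi (bounded_mfunM bB bNt).
congr (_ + _).
  by rewrite patchE mem_set// /K/= !cutoffE// mulrDl mulrA.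
rewrite -RintegralZl// -RintegralD//; last first.
  exact: (bounded_mfun_integrable (bounded_mfun_cst _ (i == l)%:R) iR).
by apply: eq_Rintegral => e _; rewrite /K/=; ring.
Qed.

Let bounded_G i l j s :
  bounded_mfun (fun t => I (fun e => chi e * (K i l (e, s) * N i j (e, t)))).
Proof.
have bH : bounded_mfun (fun z : R * R => K i l (z.2, s) * N i j (z.2, z.1)).
  apply: bounded_mfunM; last exact: bounded_mfun_swap.
  exact: (bounded_mfun_comp measurable_snd (bounded_section s (bounded_K i l))).
have := bounded_mfun_Rintegral ichi bH.
by under eq_fun do under eq_Rintegral do rewrite /= mulrC.
Qed.

Let M' i j := (fun t => M t i j) \_ `[a, b].

Let bounded_M' i j : bounded_mfun (M' i j).
Proof.
have [mM bM] := bmM i j.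
by apply: bounded_mfun_restrict => //; exact: measurable_itv.
Qed.

Let bounded_Q l j s : bounded_mfun (Q l j s).
Proof.
apply: bounded_mfun_sum => i; apply: bounded_mfunD => //.
by apply: (bounded_mfunM _ (bounded_M' i j)); exact: bounded_section.
Qed.

(** Outside [E3], [M t] carries the factor [ramp_kernel (t, s)], which is 0 for [t < s] and [t - s]
    for [s < t]; this is why [M] occurs in [E2] and not in [E1]. *)
Let opP_RE (y : R -> 'cV[R]_n) s l
    (Y := fun j => (fun t => y t j ord0) \_ `[a, b]) :
  (forall j, L1 (Y j)) -> s \in `[a, b] ->
  opP a b (fun=> 0) (R1 a b B M N1 N2) (R2 a b B M N1 N2) y s l ord0 =
  \sum_j I (fun t => Q l j s t * Y j t).
Proof.
move=> iY sab; have := sab; rewrite in_itv/= => /andP[as_ sb].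
rewrite (opPE iY _ (Q := fun j => Q l j s)) //.
- by rewrite big1 ?add0r// => j _; rewrite mxE mul0r.
- move=> j t /andP[at_ ts].
  have tab : t \in `[a, b] by rewrite in_itv/= at_; lra.
  rewrite QE// /R1 mxE E1E// /ramp_kernel /= !cutoffE// max_l; last lra.
  by rewrite mul0r add0r.
- move=> j t /andP[st tb].
  have tab : t \in `[a, b] by rewrite in_itv/= tb andbT; lra.
  by rewrite QE// /R2 mxE E2E// /ramp_kernel /= !cutoffE// max_r//; lra.
Qed.

Let opP_NE (y : R -> 'cV[R]_n) e i
    (Y := fun j => (fun t => y t j ord0) \_ `[a, b]) :
  (forall j, L1 (Y j)) -> e \in `[a, b] ->
  opP a b M N1 N2 y e i ord0 =
  \sum_j (M e i j * y e j ord0 + I (fun t => N i j (e, t) * Y j t)).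
Proof.
move=> iY eab; have := eab; rewrite in_itv/= => /andP[ae eb].
rewrite (opPE iY _ (Q := fun j t => N i j (e, t))) ?big_split//.
- by move=> j; exact: (bounded_mfun_comp (pair1_measurable e) (bounded_N i j)).
- move=> j t /andP[at_ te]; rewrite NE_lt// in_itv/= at_; lra.
- move=> j t /andP[et tb]; rewrite NE_gt// in_itv/= tb andbT; lra.
Qed.

(** * The state as a kernel integral, and the exchange of integrals *)

Section Trajectory.
Variables (x xs xss : R -> 'cV[R]_n).
Hypotheses (dx : vweak_derivative a b x xs) (dxs : vweak_derivative a b xs xss).
Hypotheses (cx : {within `[a, b], continuous x})
  (cxs : {within `[a, b], continuous xs}).
Hypothesis bc : B *m col_mx (col_mx (x a) (x b)) (col_mx (xs a) (xs b)) = 0.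

Let Y l := (fun t => xss t l ord0) \_ `[a, b].

Let iY l : L1 (Y l).
Proof. by apply: in_L2_integrable; case: (dxs l). Qed.

Let continuous_entry (z : R -> 'cV[R]_n) i :
  {within `[a, b], continuous z} ->
  {within `[a, b], continuous (fun t => z t i ord0)}.
Proof.
move=> cz t; apply: (@continuous_comp _ _ _ (z : subspace `[a, b] -> _)
  (fun A : 'cV[R]_n => A i ord0)); first exact: cz.
exact: coord_continuous.
Qed.

Let xE e i : e \in `[a, b] ->
  x e i ord0 = \sum_l I (fun s => K i l (e, s) * Y l s).
Proof.
move=> eab.
have aab : a \in `[a, b] by rewrite in_itv/= lexx ltW.
have bab : b \in `[a, b] by rewrite in_itv/= lexx ltW.
have iR t l : L1 (fun s => ramp_kernel a b (t, s) * Y l s).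
  apply: bounded_mfun_integrable => //.
  exact: (bounded_mfun_comp (pair1_measurable t)
                            (bounded_mfun_ramp_kernel a b)).
have xE0 t l : t \in `[a, b] -> x t l ord0 =
    x a l ord0 + (t - a) * xs a l ord0 +
    I (fun s => ramp_kernel a b (t, s) * Y l s).
  by move=> tab; apply: double_primitive (dx l) (dxs l) _ _ tab;
    exact: continuous_entry.
have iZ c f : L1 f -> L1 (fun t => c * f t).
  by apply: bounded_mfun_integrable; exact: bounded_mfun_cst.
(* At [b] the ramp kernel equals [b - s] on [[a, b]], the source of the factor [b - eta] in [Ba]. *)
pose z1 : 'cV[R]_n := \col_l I (fun s => ramp_kernel a b (b, s) * Y l s).
pose z2 : 'cV[R]_n := \col_l I (Y l).
have w : col_mx (x a) (xs a) = B3 a b B *m col_mx z1 z2.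
  apply: boundary_solve => //; rewrite -[RHS]bc.
  congr (_ *m col_mx (col_mx _ _) (col_mx _ _)).
    by apply/colP => l; rewrite !mxE [RHS]xE0.
  apply/colP => l; rewrite !mxE /Y -Rintegral_mkcond.
  rewrite -(weak_derivative_primitive (dxs l) _ (ltW ab) (lexx b)).
    by rewrite addrC subrK.
  exact: continuous_entry.
have -> : x e i ord0 = (B45 a b B e *m col_mx z1 z2) i ord0 +
    I (fun s => ramp_kernel a b (e, s) * Y i s).
  rewrite xE0//; congr (_ + _).
  by rewrite /B45 -mulmxA -w mul_row_col mul1mx mul_scalar_mx !mxE.
rewrite -[B45 a b B e]hsubmxK mul_row_col -/(B4 a b B e) -/(B5 a b B e).
rewrite !mxE -big_split/=.
rewrite [X in _ + X](_ : _ = \sum_l (i == l)%:R *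
    I (fun s => ramp_kernel a b (e, s) * Y l s)); last first.
  rewrite (bigD1 i)//= eqxx mul1r big1 ?addr0// => l.
  by rewrite eq_sym => /negbTE ->; rewrite mul0r.
rewrite -big_split/=; apply: eq_bigr => l _; rewrite !mxE.
rewrite -!RintegralZl// -?RintegralD//.
- apply: eq_Rintegral => s _; rewrite /K /Ba/= !mxE (cutoffE eab).
  rewrite /Y patchE; case: ifPn => [sab|_]; last by rewrite !mulr0 !addr0.
  move: sab; rewrite inE/= => sab; rewrite (cutoffE sab).
  rewrite {1}/ramp_kernel/= (cutoffE bab) (cutoffE sab).
  have := sab; rewrite in_itv/= => /andP[as_ sb].
  by rewrite max_r ?subr_ge0//; ring.
- exact: (integrableD _ (iZ _ _ (iR b l)) (iZ _ _ (iY l))).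
- exact: (iZ _ _ (iR e l)).
- exact: (iZ _ _ (iR b l)).
- exact: (iZ _ _ (iY l)).
- exact: iY.
Qed.

Let iM'Y i j : L1 (fun t => M' i j t * Y j t).
Proof. exact: bounded_mfun_integrable. Qed.

(** The exchange is done entry by entry. The terms from [M] ([T1], [P1]) need one exchange with the
    integrable weight [M' i j e * Y j e]; those from [N1], [N2] ([T2], [P2]) need the composition of
    two kernels. In [T2] both inner integrals are merely bounded in [e], and [chi] supplies the
    integrable weight. *)
Lemma L2dot_opP : L2dot a b x (opP a b M N1 N2 xss) =
  L2dot a b xss
    (opP a b (fun=> 0) (R1 a b B M N1 N2) (R2 a b B M N1 N2) xss).
Proof.
pose T1 i l j e := M' i j e * Y j e * I (fun s => K i l (e, s) * Y l s).
pose T2 i l j e :=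
  chi e * I (fun s => K i l (e, s) * Y l s) * I (fun t => N i j (e, t) * Y j t).
pose P1 i l j s := Y l s * I (fun t => K i l (t, s) * (M' i j t * Y j t)).
pose P2 i l j s := Y l s *
  I (fun t => I (fun e => chi e * (K i l (e, s) * N i j (e, t))) * Y j t).
have bKY i l := bounded_mfun_Rintegral (iY l) (bounded_K i l).
have bNY i j := bounded_mfun_Rintegral (iY j) (bounded_N i j).
have iT1 i l j : L1 (T1 i l j).
  rewrite /T1; under eq_fun do rewrite mulrC.
  exact: (bounded_mfun_integrable (bKY i l)).
have iT2 i l j : L1 (T2 i l j).
  rewrite /T2; under eq_fun do rewrite -mulrA.
  exact: (i_chi (bounded_mfunM (bKY i l) (bNY i j))).
have iP1 i l j : L1 (P1 i l j) by exact: integrable_kernel.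
have iP2 i l j : L1 (P2 i l j) by exact: integrable_kernel_comp.
have iT i l j : L1 (fun e => T1 i l j e + T2 i l j e).
  exact: (integrableD _ (iT1 i l j) (iT2 i l j)).
have iP i l j : L1 (fun s => P1 i l j s + P2 i l j s).
  exact: (integrableD _ (iP1 i l j) (iP2 i l j)).
have chi_in t : t \in `[a, b] -> chi t = 1.
  by move=> tab; rewrite /chi indicE mem_set.
have chi_out t : t \notin `[a, b] -> chi t = 0.
  by move=> tab; rewrite /chi indicE memNset//=; exact/negP.
have M'_in i j t : t \in `[a, b] -> M' i j t = M t i j.
  by move=> tab; rewrite /M' patchE mem_set.
have Y_in l t : t \in `[a, b] -> Y l t = xss t l ord0.
  by move=> tab; rewrite /Y patchE mem_set.
have Y_out l t : t \notin `[a, b] -> Y l t = 0.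
  by move=> tab; rewrite /Y patchE memNset//; exact/negP.
transitivity (\sum_i \sum_l \sum_j (I (T1 i l j) + I (T2 i l j))).
  rewrite /L2dot Rintegral_mkcond -chiM.
  transitivity (I (fun e => \sum_i \sum_l \sum_j (T1 i l j e + T2 i l j e))).
    apply: eq_Rintegral => e _.
    have [eab|eab] := boolP (e \in `[a, b]); last first.
      rewrite chi_out// mul0r big1// => i _; rewrite big1// => l _.
      by rewrite big1// => j _; rewrite /T1 /T2 chi_out// Y_out//
        !mulr0 !mul0r addr0.
    rewrite chi_in// mul1r mxE; apply: eq_bigr => i _.
    rewrite mxE xE// (opP_NE i iY eab) big_distrlr/=.
    apply: eq_bigr => l _; apply: eq_bigr => j _.
    by rewrite /T1 /T2 chi_in// -(Y_in j _ eab) M'_in//; ring.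
  rewrite Rintegral_sum; last by move=> i; do 2 apply: integrable_sum_EFin => ?.
  apply: eq_bigr => i _; rewrite Rintegral_sum; last first.
    by move=> l; apply: integrable_sum_EFin.
  apply: eq_bigr => l _; rewrite Rintegral_sum//.
  by apply: eq_bigr => j _; rewrite RintegralD.
transitivity (\sum_l \sum_j \sum_i (I (P1 i l j) + I (P2 i l j))); last first.
  symmetry; rewrite /L2dot Rintegral_mkcond -chiM.
  transitivity (I (fun s => \sum_l \sum_j \sum_i (P1 i l j s + P2 i l j s))).
    apply: eq_Rintegral => s _.
    have [sab|sab] := boolP (s \in `[a, b]); last first.
      rewrite chi_out// mul0r big1// => l _; rewrite big1// => j _.
      by rewrite big1// => i _; rewrite /P1 /P2 Y_out// !mul0r addr0.
    rewrite chi_in// mul1r mxE; apply: eq_bigr => l _.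
    rewrite mxE (opP_RE l iY sab) mulr_sumr; apply: eq_bigr => j _.
    rewrite -(Y_in l _ sab) /P1 /P2.
    have iKMY i : L1 (fun t => K i l (t, s) * (M' i j t * Y j t)).
      by apply: bounded_mfun_integrable => //; exact: bounded_section.
    have iGY i : L1 (fun t =>
        I (fun e => chi e * (K i l (e, s) * N i j (e, t))) * Y j t).
      exact: bounded_mfun_integrable.
    transitivity (Y l s * I (fun t => \sum_i
        (K i l (t, s) * (M' i j t * Y j t) +
         I (fun e => chi e * (K i l (e, s) * N i j (e, t))) * Y j t))).
      congr (_ * _); apply: eq_Rintegral => t _; rewrite mulr_suml.
      by apply: eq_bigr => i _; rewrite mulrDl mulrA.
    rewrite Rintegral_sum; last first.
      by move=> i; exact: (integrableD _ (iKMY i) (iGY i)).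
    rewrite mulr_sumr; apply: eq_bigr => i _.
    by rewrite RintegralD// mulrDr.
  rewrite Rintegral_sum; last by move=> l; do 2 apply: integrable_sum_EFin => ?.
  apply: eq_bigr => l _; rewrite Rintegral_sum; last first.
    by move=> j; apply: integrable_sum_EFin.
  apply: eq_bigr => j _; rewrite Rintegral_sum//.
  by apply: eq_bigr => i _; rewrite RintegralD.
rewrite exchange_big; apply: eq_bigr => l _; rewrite exchange_big.
apply: eq_bigr => j _; apply: eq_bigr => i _; congr (_ + _).
  by rewrite /T1 /P1 Rintegral_swap.
by rewrite /T2 /P2 Rintegral_kernel_comp.
Qed.

End Trajectory.
End KernelForm.

(** [B2_inv] is what makes [Ba] determined by [B], and full row rank does not imply it: for periodic
    conditions [x(a) = x(b)], [xs(a) = xs(b)] the matrix [B2] is singular, and [invmx] would return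
    [B2] itself. *)
Theorem lemma4 (R : realType) (a b : R) (n : nat)
    (B : 'M[R]_(n + n, (n + n) + (n + n)))
    (M : R -> 'M[R]_n) (N1 N2 : R -> R -> 'M[R]_n)
    (x xs xss : R -> 'cV[R]_n)
    (ab : a < b) (n_gt0 : (0 < n)%N)
    (rankB : \rank B = (n + n)%N)
    (B2_inv : B2 a b B \in unitmx)
    (bmM : bounded_measurable1 a b M)
    (bmN1 : bounded_measurable2 a b N1)
    (bmN2 : bounded_measurable2 a b N2)
    (W32x : vsobolev a b 3 x)
    (dx : vweak_derivative a b x xs)
    (dxs : vweak_derivative a b xs xss)
    (* boundary values are those of the continuous representatives *)
    (cx : {within `[a, b], continuous x})
    (cxs : {within `[a, b], continuous xs})
    (bc : B *m col_mx (col_mx (x a) (x b)) (col_mx (xs a) (xs b)) = 0) :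
  L2dot a b x (opP a b M N1 N2 xss) =
  L2dot a b xss
    (opP a b (fun=> 0) (R1 a b B M N1 N2) (R2 a b B M N1 N2) xss).
Proof. exact: L2dot_opP. Qed.
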